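(* Let $(G,v)$ be a $\mathbb{T}^{(\infty,0)}$-algebra (a weak $\infty$-groupoid) of dimension $1$, and let $f:a\to b$ be a $1$-cell of $G$ (i.e. $f\in G(1)$ with $s^1_0(f)=a$, $t^1_0(f)=b$). Then $f$ is a $\circ^1_0$-isomorphism.
   Context: **$\infty$-graphs.** An $\infty$-graph (globular set) $X$ consists of sets $X(m)=X_m$ ($m\in\mathbb{N}$), whose elements are called $m$-cells, and maps $s^{m+1}_m,t^{m+1}_m:X(m+1)\to X(m)$ with $s^{m}_{m-1}s^{m+1}_m=s^{m}_{m-1}t^{m+1}_m$ and $t^{m}_{m-1}t^{m+1}_m=t^{m}_{m-1}s^{m+1}_m$. For $p<m$, $s^m_p$ and $t^m_p$ denote the iterated sources and targets. Morphisms are maps commuting with sources and targets; the category is $\infty\text{-}\mathbb{G}\mathrm{r}$. **Reflexive $\infty$-graphs.** An $\infty$-graph with maps (reflexors) $1^m_{m+1}:X(m)\to X(m+1)$ with $s^{m+1}_m1^m_{m+1}=t^{m+1}_m1^m_{m+1}=\mathrm{id}$; put $1^p_m=1^{m-1}_m\circ\cdots\circ 1^p_{p+1}$ for $p<m$. A $q$-cell ($q\ge1$) is an identity cell if it lies in the image of $1^{q-1}_q$. A reflexive $\infty$-graph has dimension $p$ if all its $q$-cells with $q>p$ are identity cells and at least one $p$-cell is not an identity cell. **$(\infty,n)$-reversible structure** on an $\infty$-graph $X$: maps (reversors) $j^m_p:X_m\to X_m$ for $n\le p<m$ such that $s^{p+1}_pj^{p+1}_p=t^{p+1}_p$, $t^{p+1}_pj^{p+1}_p=s^{p+1}_p$,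 and for $m\ge p+2$, $s^m_{m-1}j^m_p=j^{m-1}_ps^m_{m-1}$ and $t^m_{m-1}j^m_p=j^{m-1}_pt^m_{m-1}$. **$\infty$-magmas.** A reflexive $\infty$-graph $M$ with composition maps $\circ^m_p$ ($0\le p<m$) sending each pair $(y,x)\in M(m)\times M(m)$ with $s^m_p(y)=t^m_p(x)$ to $y\circ^m_px\in M(m)$, subject only to the positional axioms: for $p<q<m$, $s^m_q(y\circ^m_px)=s^m_q(y)\circ^q_ps^m_q(x)$ and $t^m_q(y\circ^m_px)=t^m_q(y)\circ^q_pt^m_q(x)$; for $q\le p$, $s^m_q(y\circ^m_px)=s^m_q(x)$ and $t^m_q(y\circ^m_px)=t^m_q(y)$. Morphisms preserve reflexors and compositions. An $(\infty,n)$-magma is an $\infty$-magma whose underlying $\infty$-graph is equipped with an $(\infty,n)$-reversible structure (no compatibility with the reflexors or compositions is required); morphisms are morphisms of $\infty$-magmas that also commute with the reversors. **Strict $(\infty,n)$-categories.** A strict $\infty$-category is an $\infty$-magma in which the compositions are associative, unital ($x\circ^m_p1^p_m(s^m_p(x))=x=1^p_m(t^m_p(x))\circ^m_px$), satisfy the interchange laws, and $1^p_m(y\circ^p_qx)=1^p_m(y)\circ^m_q1^p_m(x)$ for $q<p<m$. A strict $(\infty,n)$-category is a strict $\infty$-category in which, for all $n\le p<m$, every $m$-cell $\alpha$ has a $\circ^m_p$-inverse $\beta$: $\alpha\circ^m_p\beta=1^p_m(t^m_p(\alpha))$ and $\beta\circ^m_p\alpha=1^p_m(s^m_p(\alpha))$.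 The inverse is unique, and $j^m_p(\alpha):=\beta$ makes every strict $(\infty,n)$-category an $(\infty,n)$-magma. Morphisms are strict $\infty$-functors. **$(\infty,n)$-categorical stretchings.** A tuple $(M,C,\pi,([-,-]_m)_{m\in\mathbb{N}})$ with $M$ an $(\infty,n)$-magma, $C$ a strict $(\infty,n)$-category, $\pi:M\to C$ a morphism of $(\infty,n)$-magmas, and maps $[-,-]_m:\widetilde M_m\to M_{m+1}$, where $\widetilde M_m=\{(c_1,c_0)\in M_m\times M_m: c_1\|c_0,\ \pi_m(c_1)=\pi_m(c_0)\}$, such that $t^{m+1}_m([c_1,c_0]_m)=c_1$, $s^{m+1}_m([c_1,c_0]_m)=c_0$, $\pi_{m+1}([c_1,c_0]_m)=1^m_{m+1}(\pi_m(c_1))=1^m_{m+1}(\pi_m(c_0))$, and $[c,c]_m=1^m_{m+1}(c)$. Here for $m\ge1$, $c_1\|c_0$ means that $c_1$ and $c_0$ have the same $s^m_{m-1}$ and the same $t^m_{m-1}$; any two $0$-cells are parallel. A morphism $(M,C,\pi,[-,-])\to(M',C',\pi',[-,-]')$ is a pair $(f,c)$ of a morphism of $(\infty,n)$-magmas $f:M\to M'$ and a strict $\infty$-functor $c:C\to C'$ with $\pi'f=c\pi$ and $f_{m+1}([c_1,c_0]_m)=[f_m(c_1),f_m(c_0)]'_m$. The category is $(\infty,n)\text{-}\mathbb{E}\mathrm{t}\mathbb{C}\mathrm{at}$. **The monad.** The forgetful functor $U_n:(\infty,n)\text{-}\mathbb{E}\mathrm{t}\mathbb{C}\mathrm{at}\to\infty\text{-}\mathbb{G}\mathrm{r}$,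 $(M,C,\pi,[-,-])\mapsto M$, has a left adjoint $F_n$. The induced monad on $\infty\text{-}\mathbb{G}\mathrm{r}$ is $\mathbb{T}^{(\infty,n)}=(T^n,\mu^n,\lambda^n)$. A weak $(\infty,n)$-category is a $\mathbb{T}^{(\infty,n)}$-algebra $(G,v)$, $v:T^n(G)\to G$; for $n=0$ it is called a weak $\infty$-groupoid. **Operations on an algebra.** $T^n(G)$ is the underlying $\infty$-graph of the free $(\infty,n)$-magma part $M^n(G)$ of $F_n(G)$; write $\star^m_p$, $1^p_m$, $j^m_p$ for the compositions, reflexors and reversors of $M^n(G)$. On a $\mathbb{T}^{(\infty,n)}$-algebra $(G,v)$ put $a\circ^m_pb:=v_m(\lambda^n_G(a)\star^m_p\lambda^n_G(b))$ when $s^m_p(a)=t^m_p(b)$; $\iota^p_m(a):=v_m(1^p_m(\lambda^n_G(a)))$ for $a\in G(p)$, $p<m$; $i^m_p(a):=v_m(j^m_p(\lambda^n_G(a)))$ for $a\in G(m)$, $n\le p<m$. The algebra $(G,v)$ has dimension $p$ if $G$, as a reflexive $\infty$-graph with reflexors $\iota^p_m$, has dimension $p$. **Isomorphisms.** A $1$-cell $f:a\to b$ of $G$ is a $\circ^1_0$-isomorphism if there is a $1$-cell $g:b\to a$ of $G$ with $f\circ^1_0g=\iota^0_1(b)$ and $g\circ^1_0f=\iota^0_1(a)$. *)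

(* Defs.v *)
From mathcomp Require Import all_boot.
From mathcomp Require Import boolp.

Set Implicit Arguments.
Unset Strict Implicit.
Unset Printing Implicit Defensive.

(* Conventions.
   - The superscript and subscript of an operation such as s^m_p are recovered
     from its argument of type p < m (a boolean inequality, hence with a unique
     proof).
   - A composition takes a proof of composability.  Where an axiom involves
     composites whose composability follows from the positional axioms (or from
     compatibility with sources and targets), it is stated for all such proofs;
     they always exist, and the choice is irrelevant by proof irrelevance. *)

Lemma leq_case (p m : nat) : p <= m -> {p = m} + {p < m}.
Proof. by rewrite leq_eqVlt; case: (eqVneq p m) => [|_] e; [left | right]. Defined.

Section Iteration.
Variable X : nat -> Type.

Fixpoint down (d : forall m, X m.+1 -> X m) (m p : nat) : p < m -> X m -> X p :=
  match m return p < m -> X m -> X p with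
  | 0 => fun h _ => False_rect _ (elimF idP (ltn0 p) h)
  | m'.+1 => fun h x =>
      match @leq_case p m' h with
      | left e => eq_rect_r X (d m' x) e
      | right h' => down d h' (d m' x)
      end
  end.

Fixpoint up (u : forall m, X m -> X m.+1) (p m : nat) : p < m -> X p -> X m :=
  match m return p < m -> X p -> X m with
  | 0 => fun h _ => False_rect _ (elimF idP (ltn0 p) h)
  | m'.+1 => fun h x =>
      match @leq_case p m' h with
      | left e => u m' (eq_rect p X x m' e)
      | right h' => u m' (up u h' x)
      end
  end.

Lemma downS d m (h : m < m.+1) x : down d h x = d m x.
Proof.
rewrite /=; case: leq_case => [e|h']; last by exfalso; move: h'; rewrite ltnn.
by rewrite (eq_irrelevance e erefl).
Qed.

Lemma down_lt d m p (h : p < m.+1) (h' : p < m) x :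
  down d h x = down d h' (d m x).
Proof.
rewrite /=; case: leq_case => [e|h2].
  by exfalso; move: h'; rewrite e ltnn.
by rewrite (bool_irrelevance h2 h').
Qed.

Lemma upS u m (h : m < m.+1) x : up u h x = u m x.
Proof.
rewrite /=; case: leq_case => [e|h']; last by exfalso; move: h'; rewrite ltnn.
by rewrite (eq_irrelevance e erefl).
Qed.

Lemma up_lt u p m (h : p < m.+1) (h' : p < m) x : up u h x = u m (up u h' x).
Proof.
rewrite /=; case: leq_case => [e|h2].
  by exfalso; move: h'; rewrite e ltnn.
by rewrite (bool_irrelevance h2 h').
Qed.

End Iteration.

Record igraph := IGraph {
  cell :> nat -> Type;
  source : forall m, cell m.+1 -> cell m;
  target : forall m, cell m.+1 -> cell m;
  source_target : forall m (x : cell m.+2),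
    source (target x) = source (source x);
  target_source : forall m (x : cell m.+2),
    target (source x) = target (target x) }.

Definition src (X : igraph) m p (h : p < m) : X m -> X p := down (@source X) h.
Definition tgt (X : igraph) m p (h : p < m) : X m -> X p := down (@target X) h.

Section IteratedFaces.
Variable X : igraph.

Lemma srcS m (h : m < m.+1) (x : X m.+1) : src h x = source x.
Proof. exact: downS. Qed.

Lemma tgtS m (h : m < m.+1) (x : X m.+1) : tgt h x = target x.
Proof. exact: downS. Qed.

Lemma src_source m p (h : p < m.+1) (h' : p < m) (x : X m.+1) :
  src h' (source x) = src h x.
Proof. by rewrite /src (down_lt _ h h'). Qed.

Lemma tgt_target m p (h : p < m.+1) (h' : p < m) (x : X m.+1) :
  tgt h' (target x) = tgt h x.
Proof. by rewrite /tgt (down_lt _ h h'). Qed.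

Lemma src_target m p (h : p < m.+1) (h' : p < m) (x : X m.+1) :
  src h' (target x) = src h x.
Proof.
rewrite -(src_source h h'); case: m h h' x => // m h h' x.
by rewrite /src /= source_target.
Qed.

Lemma tgt_source m p (h : p < m.+1) (h' : p < m) (x : X m.+1) :
  tgt h' (source x) = tgt h x.
Proof.
rewrite -(tgt_target h h'); case: m h h' x => // m h h' x.
by rewrite /tgt /= target_source.
Qed.

End IteratedFaces.

Record igraph_hom (X Y : igraph) := IGraphHom {
  igraph_fun :> forall m, X m -> Y m;
  hom_source : forall m (x : X m.+1),
    igraph_fun (source x) = source (igraph_fun x);
  hom_target : forall m (x : X m.+1),
    igraph_fun (target x) = target (igraph_fun x) }.

Section IGraphHoms.

Lemma igraph_hom_eq X Y (f g : igraph_hom X Y) :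
  (forall m (x : X m), f m x = g m x) -> f = g.
Proof.
case: f g => [f fs ft] [g gs gt] /= fg.
have E : f = g by apply: functional_extensionality_dep => m; apply/funext/fg.
by subst g; rewrite (Prop_irrelevance gs fs) (Prop_irrelevance gt ft).
Qed.

Lemma hom_src X Y (f : igraph_hom X Y) m p (h : p < m) (x : X m) :
  f p (src h x) = src h (f m x).
Proof.
elim: m h x => // m IH h x; case: (@leq_case p m h) => [e|h'].
  by subst m; rewrite !srcS hom_source.
by rewrite -(src_source h h') IH hom_source (src_source h h').
Qed.

Lemma hom_tgt X Y (f : igraph_hom X Y) m p (h : p < m) (x : X m) :
  f p (tgt h x) = tgt h (f m x).
Proof.
elim: m h x => // m IH h x; case: (@leq_case p m h) => [e|h'].
  by subst m; rewrite !tgtS hom_target.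
by rewrite -(tgt_target h h') IH hom_target (tgt_target h h').
Qed.

Lemma hom_composable X Y (f : igraph_hom X Y) m p (h : p < m) (y x : X m) :
  src h y = tgt h x -> src h (f m y) = tgt h (f m x).
Proof. by rewrite -hom_src -hom_tgt => ->. Qed.

Definition igraph_id X : igraph_hom X X :=
  @IGraphHom X X (fun m x => x) (fun _ _ => erefl) (fun _ _ => erefl).

Definition igraph_comp X Y Z (g : igraph_hom Y Z) (f : igraph_hom X Y) :
  igraph_hom X Z.
Proof.
by exists (fun m x => g m (f m x)) => m x; rewrite ?hom_source ?hom_target.
Defined.

End IGraphHoms.

Record rgraph := RGraph {
  rgraph_graph :> igraph;
  reflexor : forall m, rgraph_graph m -> rgraph_graph m.+1;
  source_reflexor : forall m (x : rgraph_graph m), source (reflexor x) = x;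
  target_reflexor : forall m (x : rgraph_graph m), target (reflexor x) = x }.

Definition refl (X : rgraph) p m (h : p < m) : X p -> X m := up (@reflexor X) h.

Definition identity_cell (X : rgraph) (q : nat) : X q -> Prop :=
  match q return X q -> Prop with
  | 0 => fun _ => False
  | q'.+1 => fun x => exists y : X q', x = reflexor y
  end.

Definition has_dimension (X : rgraph) (p : nat) : Prop :=
  (forall q, p < q -> forall x : X q, identity_cell x) /\
  (exists x : X p, ~ identity_cell x).

Section IteratedReflexors.
Variable X : rgraph.

Lemma src_refl p m (h : p < m) (x : X p) : src h (refl h x) = x.
Proof.
elim: m h => // m IH h; case: (@leq_case p m h) => [e|h'].
  by subst m; rewrite srcS /refl upS source_reflexor.
by rewrite -(src_source h h') /refl (up_lt _ h h') source_reflexor IH.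
Qed.

Lemma tgt_refl p m (h : p < m) (x : X p) : tgt h (refl h x) = x.
Proof.
elim: m h => // m IH h; case: (@leq_case p m h) => [e|h'].
  by subst m; rewrite tgtS /refl upS target_reflexor.
by rewrite -(tgt_target h h') /refl (up_lt _ h h') target_reflexor IH.
Qed.

End IteratedReflexors.

Record reversible (n : nat) (X : igraph) := Reversible {
  rev_map : forall m p, n <= p -> p < m -> X m -> X m;
  source_rev_top : forall p (hn : n <= p) (h : p < p.+1) (x : X p.+1),
    source (rev_map hn h x) = target x;
  target_rev_top : forall p (hn : n <= p) (h : p < p.+1) (x : X p.+1),
    target (rev_map hn h x) = source x;
  source_rev : forall m p (hn : n <= p) (h : p < m) (h' : p < m.+1)
      (x : X m.+1),
    source (rev_map hn h' x) = rev_map hn h (source x);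
  target_rev : forall m p (hn : n <= p) (h : p < m) (h' : p < m.+1)
      (x : X m.+1),
    target (rev_map hn h' x) = rev_map hn h (target x) }.

Record magma := Magma {
  magma_rgraph :> rgraph;
  mcomp : forall m p (h : p < m) (y x : magma_rgraph m),
    src h y = tgt h x -> magma_rgraph m;
  src_mcomp_gt : forall m q p (hpq : p < q) (hqm : q < m) (hpm : p < m)
      (y x : magma_rgraph m) (H : src hpm y = tgt hpm x)
      (H' : src hpq (src hqm y) = tgt hpq (src hqm x)),
    src hqm (mcomp H) = mcomp H';
  tgt_mcomp_gt : forall m q p (hpq : p < q) (hqm : q < m) (hpm : p < m)
      (y x : magma_rgraph m) (H : src hpm y = tgt hpm x)
      (H' : src hpq (tgt hqm y) = tgt hpq (tgt hqm x)),
    tgt hqm (mcomp H) = mcomp H';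
  src_mcomp_le : forall m p q (hqm : q < m) (hpm : p < m)
      (y x : magma_rgraph m) (H : src hpm y = tgt hpm x),
    q <= p -> src hqm (mcomp H) = src hqm x;
  tgt_mcomp_le : forall m p q (hqm : q < m) (hpm : p < m)
      (y x : magma_rgraph m) (H : src hpm y = tgt hpm x),
    q <= p -> tgt hqm (mcomp H) = tgt hqm y }.

Arguments mcomp {M m p h} y x H : rename.

Record magma_hom (M N : magma) := MagmaHom {
  magma_fun :> igraph_hom M N;
  hom_reflexor : forall m (x : M m),
    magma_fun m.+1 (reflexor x) = reflexor (magma_fun m x);
  hom_mcomp : forall m p (h : p < m) (y x : M m) (H : src h y = tgt h x)
      (H' : src h (magma_fun m y) = tgt h (magma_fun m x)),
    magma_fun m (mcomp y x H) = mcomp (magma_fun m y) (magma_fun m x) H' }.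

Arguments hom_mcomp {M N} f {m p h y x} H H' : rename.

Section MagmaHoms.

Lemma magma_hom_eq M N (f g : magma_hom M N) :
  (forall m (x : M m), f m x = g m x) -> f = g.
Proof.
case: f g => [f fr fc] [g gr gc] /= /igraph_hom_eq E; subst g.
by rewrite (Prop_irrelevance gr fr) (Prop_irrelevance gc fc).
Qed.

Definition magma_id M : magma_hom M M.
Proof.
exists (igraph_id M) => //= m p h y x H H'.
by rewrite (Prop_irrelevance H' H).
Defined.

Definition magma_comp L M N (g : magma_hom M N) (f : magma_hom L M) :
  magma_hom L N.
Proof.
exists (igraph_comp g f) => /= [m x | m p h y x H H'].
  by rewrite !hom_reflexor.
by rewrite (hom_mcomp f H (hom_composable f H)) (hom_mcomp g _ H').
Defined.

End MagmaHoms.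

Record nmagma (n : nat) := NMagma {
  nmagma_magma :> magma;
  nmagma_rev : reversible n nmagma_magma }.

Definition reversor n (M : nmagma n) m p (hn : n <= p) (h : p < m) : M m -> M m :=
  rev_map (nmagma_rev M) hn h.

Record nmagma_hom n (M N : nmagma n) := NMagmaHom {
  nmagma_fun :> magma_hom M N;
  hom_rev : forall m p (hn : n <= p) (h : p < m) (x : M m),
    nmagma_fun m (reversor hn h x) = reversor hn h (nmagma_fun m x) }.

Section NMagmaHoms.
Variable n : nat.

Lemma nmagma_hom_eq (M N : nmagma n) (f g : nmagma_hom M N) :
  (forall m (x : M m), f m x = g m x) -> f = g.
Proof.
case: f g => [f fr] [g gr] /= /magma_hom_eq E; subst g.
by rewrite (Prop_irrelevance gr fr).
Qed.

Definition nmagma_id (M : nmagma n) : nmagma_hom M M :=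
  @NMagmaHom n M M (magma_id M) (fun _ _ _ _ _ => erefl).

Definition nmagma_comp (L M N : nmagma n)
  (g : nmagma_hom M N) (f : nmagma_hom L M) : nmagma_hom L N.
Proof. by exists (magma_comp g f) => m p hn h x /=; rewrite !hom_rev. Defined.

End NMagmaHoms.

Record scat := SCat {
  scat_magma :> magma;
  mcompA : forall m p (h : p < m) (z y x : scat_magma m)
      (H1 : src h z = tgt h y) (H2 : src h y = tgt h x)
      (H3 : src h (mcomp z y H1) = tgt h x)
      (H4 : src h z = tgt h (mcomp y x H2)),
    mcomp (mcomp z y H1) x H3 = mcomp z (mcomp y x H2) H4;
  mcomp_refl : forall m p (h : p < m) (x : scat_magma m)
      (H : src h x = tgt h (refl h (src h x))),
    mcomp x (refl h (src h x)) H = x;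
  refl_mcomp : forall m p (h : p < m) (x : scat_magma m)
      (H : src h (refl h (tgt h x)) = tgt h x),
    mcomp (refl h (tgt h x)) x H = x;
  interchange : forall m p q (hqp : q < p) (hpm : p < m) (hqm : q < m)
      (y' y x' x : scat_magma m)
      (H1 : src hpm y' = tgt hpm y) (H2 : src hpm x' = tgt hpm x)
      (H3 : src hqm (mcomp y' y H1) = tgt hqm (mcomp x' x H2))
      (H4 : src hqm y' = tgt hqm x') (H5 : src hqm y = tgt hqm x)
      (H6 : src hpm (mcomp y' x' H4) = tgt hpm (mcomp y x H5)),
    mcomp (mcomp y' y H1) (mcomp x' x H2) H3 =
    mcomp (mcomp y' x' H4) (mcomp y x H5) H6;
  refl_of_mcomp : forall m p q (hqp : q < p) (hpm : p < m) (hqm : q < m)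
      (y x : scat_magma p) (H : src hqp y = tgt hqp x)
      (H' : src hqm (refl hpm y) = tgt hqm (refl hpm x)),
    refl hpm (mcomp y x H) = mcomp (refl hpm y) (refl hpm x) H' }.

Definition is_inverse (C : scat) m p (h : p < m) (a b : C m) : Prop :=
  exists (H : src h a = tgt h b) (H' : src h b = tgt h a),
    mcomp a b H = refl h (tgt h a) /\ mcomp b a H' = refl h (src h a).

Record nscat (n : nat) := NSCat {
  nscat_scat :> scat;
  has_inverse : forall m p, n <= p -> forall (h : p < m) (a : nscat_scat m),
    exists b : nscat_scat m, is_inverse h a b }.

Section StrictInverses.

Lemma mcomp_congr (M : magma) m p (h : p < m) (y y' x x' : M m)
    (H : src h y = tgt h x) (H' : src h y' = tgt h x') :
  y = y' -> x = x' -> mcomp y x H = mcomp y' x' H'.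
Proof. by move=> E1 E2; subst y' x'; rewrite (Prop_irrelevance H H'). Qed.

Lemma inverse_unique (C : scat) m p (h : p < m) (a b b' : C m) :
  is_inverse h a b -> is_inverse h a b' -> b = b'.
Proof.
move=> [H1 [H2 [_ E2]]] [H3 [H4 [E3 _]]].
have Hr : src h b = tgt h (refl h (src h b)) by rewrite tgt_refl.
have Hl : src h (refl h (tgt h b')) = tgt h b' by rewrite src_refl.
have K1 : src h b = tgt h (mcomp a b' H3) by rewrite tgt_mcomp_le.
have K2 : src h (mcomp b a H2) = tgt h b' by rewrite src_mcomp_le.
rewrite -(mcomp_refl Hr) -[RHS](refl_mcomp Hl).
rewrite (mcomp_congr Hr K1 erefl); last by rewrite E3 H2.
by rewrite -(mcompA K2) (mcomp_congr K2 Hl) // E2 H3.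
Qed.

Lemma source_inverse (C : scat) m p (h : p < m) (h' : p < m.+1)
    (a b : C m.+1) :
  is_inverse h' a b -> is_inverse h (source a) (source b).
Proof.
move=> [H1 [H2 [E1 E2]]].
have K1 : src h (source a) = tgt h (source b).
  by rewrite (src_source h' h) (tgt_source h' h).
have K2 : src h (source b) = tgt h (source a).
  by rewrite (src_source h' h) (tgt_source h' h).
have R : forall x : C p, source (refl h' x) = refl h x.
  by move=> x; rewrite /refl (up_lt _ h' h) source_reflexor.
have hm := ltnSn m.
have L1 : src h (src hm a) = tgt h (src hm b) by rewrite !srcS.
have L2 : src h (src hm b) = tgt h (src hm a) by rewrite !srcS.
exists K1, K2; split.
  rewrite (tgt_source h' h) -R -E1 -(srcS hm (mcomp a b H1)).
  by rewrite (src_mcomp_gt H1 L1); apply: mcomp_congr; rewrite srcS.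
rewrite (src_source h' h) -R -E2 -(srcS hm (mcomp b a H2)).
by rewrite (src_mcomp_gt H2 L2); apply: mcomp_congr; rewrite srcS.
Qed.

Lemma target_inverse (C : scat) m p (h : p < m) (h' : p < m.+1)
    (a b : C m.+1) :
  is_inverse h' a b -> is_inverse h (target a) (target b).
Proof.
move=> [H1 [H2 [E1 E2]]].
have K1 : src h (target a) = tgt h (target b).
  by rewrite (src_target h' h) (tgt_target h' h).
have K2 : src h (target b) = tgt h (target a).
  by rewrite (src_target h' h) (tgt_target h' h).
have R : forall x : C p, target (refl h' x) = refl h x.
  by move=> x; rewrite /refl (up_lt _ h' h) target_reflexor.
have hm := ltnSn m.
have L1 : src h (tgt hm a) = tgt h (tgt hm b) by rewrite !tgtS.
have L2 : src h (tgt hm b) = tgt h (tgt hm a) by rewrite !tgtS.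
exists K1, K2; split.
  rewrite (tgt_target h' h) -R -E1 -(tgtS hm (mcomp a b H1)).
  by rewrite (tgt_mcomp_gt H1 L1); apply: mcomp_congr; rewrite tgtS.
rewrite (src_target h' h) -R -E2 -(tgtS hm (mcomp b a H2)).
by rewrite (tgt_mcomp_gt H2 L2); apply: mcomp_congr; rewrite tgtS.
Qed.

Variables (n : nat) (C : nscat n).

Definition inverse m p (hn : n <= p) (h : p < m) (a : C m) : C m :=
  projT1 (cid (has_inverse hn h a)).

Lemma inverseP m p (hn : n <= p) (h : p < m) (a : C m) :
  is_inverse h a (inverse hn h a).
Proof. exact: projT2 (cid (has_inverse hn h a)). Qed.

(* [inverse] is chosen classically; by [inverse_unique] the choice is forced. *)
Definition nscat_rev : reversible n C.
Proof.
exists inverse.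
- by move=> p hn h x; have [_ [H _]] := inverseP hn h x; rewrite -srcS H tgtS.
- by move=> p hn h x; have [H _] := inverseP hn h x; rewrite -tgtS -H srcS.
- move=> m p hn h h' x; apply: (@inverse_unique C m p h (source x)).
    exact: source_inverse (inverseP hn h' x).
  exact: inverseP.
- move=> m p hn h h' x; apply: (@inverse_unique C m p h (target x)).
    exact: target_inverse (inverseP hn h' x).
  exact: inverseP.
Defined.

Definition nscat_nmagma : nmagma n := NMagma nscat_rev.

End StrictInverses.

Record category := Category {
  obj :> Type;
  hom : obj -> obj -> Type;
  idm : forall X, hom X X;
  cmp : forall X Y Z, hom Y Z -> hom X Y -> hom X Z;
  cmp1m : forall X Y (f : hom X Y), cmp (idm Y) f = f;
  cmpm1 : forall X Y (f : hom X Y), cmp f (idm X) = f;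
  cmpA : forall X Y Z W (h : hom Z W) (g : hom Y Z) (f : hom X Y),
    cmp h (cmp g f) = cmp (cmp h g) f }.

Arguments idm {c} X.

Record functor (C D : category) := Functor {
  fobj :> C -> D;
  fmap : forall X Y, hom X Y -> hom (fobj X) (fobj Y);
  fmap1 : forall X, fmap (idm X) = idm (fobj X);
  fmapM : forall X Y Z (g : hom Y Z) (f : hom X Y),
    fmap (cmp g f) = cmp (fmap g) (fmap f) }.

Definition functor_comp (C D E : category) (G : functor D E) (F : functor C D) :
  functor C E.
Proof.
exists (fun X => G (F X)) (fun X Y f => fmap G (fmap F f)) => [X|X Y Z g f].
  by rewrite !fmap1.
by rewrite !fmapM.
Defined.

Record left_adjoint (C D : category) (U : functor D C) := LeftAdjoint {
  ladj :> functor C D;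
  adj_unit : forall X : C, hom X (U (ladj X));
  adj_counit : forall Y : D, hom (ladj (U Y)) Y;
  unit_nat : forall (X X' : C) (f : hom X X'),
    cmp (adj_unit X') f = cmp (fmap U (fmap ladj f)) (adj_unit X);
  counit_nat : forall (Y Y' : D) (g : hom Y Y'),
    cmp (adj_counit Y') (fmap ladj (fmap U g)) = cmp g (adj_counit Y);
  triangle_l : forall X : C,
    cmp (adj_counit (ladj X)) (fmap ladj (adj_unit X)) = idm (ladj X);
  triangle_r : forall Y : D,
    cmp (fmap U (adj_counit Y)) (adj_unit (U Y)) = idm (U Y) }.

Record monad (C : category) := Monad {
  mfun :> functor C C;
  mmul : forall X : C, hom (mfun (mfun X)) (mfun X);
  munit : forall X : C, hom X (mfun X);
  mmul_nat : forall (X Y : C) (f : hom X Y),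
    cmp (mmul Y) (fmap mfun (fmap mfun f)) = cmp (fmap mfun f) (mmul X);
  munit_nat : forall (X Y : C) (f : hom X Y),
    cmp (munit Y) f = cmp (fmap mfun f) (munit X);
  mmul_unit_l : forall X : C, cmp (mmul X) (munit (mfun X)) = idm (mfun X);
  mmul_unit_r : forall X : C, cmp (mmul X) (fmap mfun (munit X)) = idm (mfun X);
  mmulA : forall X : C,
    cmp (mmul X) (mmul (mfun X)) = cmp (mmul X) (fmap mfun (mmul X)) }.

Definition induced_monad (C D : category) (U : functor D C)
  (F : left_adjoint U) : monad C.
Proof.
apply: (@Monad C (functor_comp U F) (fun X => fmap U (adj_counit F (F X)))
  (fun X => adj_unit F X)) => /=.
- by move=> X Y f; rewrite -!fmapM counit_nat.
- by move=> X Y f; rewrite unit_nat.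
- by move=> X; rewrite triangle_r.
- by move=> X; rewrite -fmapM triangle_l fmap1.
- by move=> X; rewrite -!fmapM counit_nat.
Defined.

Record algebra (C : category) (T : monad C) := Algebra {
  carrier : C;
  action : hom (T carrier) carrier;
  action_unit : cmp action (munit T carrier) = idm carrier;
  action_mul : cmp action (mmul T carrier) = cmp action (fmap T action) }.

Definition IGr : category.
Proof.
apply: (@Category igraph igraph_hom igraph_id igraph_comp);
  by move=> *; apply: igraph_hom_eq.
Defined.

Definition parallel (X : igraph) (m : nat) : X m -> X m -> Prop :=
  match m return X m -> X m -> Prop with
  | 0 => fun _ _ => True
  | m'.+1 => fun c1 c0 => source c1 = source c0 /\ target c1 = target c0
  end.

Record stretching (n : nat) := Stretching {
  st_magma : nmagma n;
  st_scat : nscat n;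
  st_proj : nmagma_hom st_magma (nscat_nmagma st_scat);
  bracket : forall m (c1 c0 : st_magma m),
    parallel c1 c0 -> st_proj m c1 = st_proj m c0 -> st_magma m.+1;
  target_bracket : forall m (c1 c0 : st_magma m) H K,
    target (@bracket m c1 c0 H K) = c1;
  source_bracket : forall m (c1 c0 : st_magma m) H K,
    source (@bracket m c1 c0 H K) = c0;
  proj_bracket : forall m (c1 c0 : st_magma m) H K,
    st_proj m.+1 (@bracket m c1 c0 H K) = reflexor (st_proj m c1) /\
    st_proj m.+1 (@bracket m c1 c0 H K) = reflexor (st_proj m c0);
  bracket_refl : forall m (c : st_magma m) H K,
    @bracket m c c H K = reflexor c }.

Arguments bracket {n} E {m} c1 c0 H K : rename.

Record stretching_hom n (E E' : stretching n) := StretchingHom {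
  st_fun : nmagma_hom (st_magma E) (st_magma E');
  st_functor : magma_hom (st_scat E) (st_scat E');
  st_square : forall m (x : st_magma E m),
    st_proj E' m (st_fun m x) = st_functor m (st_proj E m x);
  st_bracket : forall m (c1 c0 : st_magma E m) H K H' K',
    st_fun m.+1 (bracket E c1 c0 H K) =
    bracket E' (st_fun m c1) (st_fun m c0) H' K' }.

Arguments st_bracket {n E E'} f {m c1 c0} H K H' K' : rename.

Section StretchingCategory.
Variable n : nat.

Lemma stretching_hom_eq (E E' : stretching n) (f g : stretching_hom E E') :
  (forall m x, st_fun f m x = st_fun g m x) ->
  (forall m x, st_functor f m x = st_functor g m x) -> f = g.
Proof.
case: f g => [f c fs fb] [g d gs gb] /= /nmagma_hom_eq E1 /magma_hom_eq E2.
subst g d.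
by rewrite (Prop_irrelevance gs fs) (Prop_irrelevance gb fb).
Qed.

Lemma hom_parallel X Y (f : igraph_hom X Y) m (c1 c0 : X m) :
  parallel c1 c0 -> parallel (f m c1) (f m c0).
Proof.
case: m c1 c0 => //= m c1 c0 [Hs Ht].
by rewrite -!hom_source -!hom_target Hs Ht.
Qed.

Definition stretching_id (E : stretching n) : stretching_hom E E.
Proof.
exists (nmagma_id (st_magma E)) (magma_id (st_scat E)) => //= m c1 c0 H K H' K'.
by rewrite (Prop_irrelevance H' H) (Prop_irrelevance K' K).
Defined.

Definition stretching_comp (E1 E2 E3 : stretching n)
  (g : stretching_hom E2 E3) (f : stretching_hom E1 E2) :
  stretching_hom E1 E3.
Proof.
exists (nmagma_comp (st_fun g) (st_fun f))
       (magma_comp (st_functor g) (st_functor f)) => /=.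
- by move=> m x; rewrite !st_square.
- move=> m c1 c0 H K H' K'.
  have K2 : st_proj E2 m (st_fun f m c1) = st_proj E2 m (st_fun f m c0).
    by rewrite !st_square K.
  rewrite (st_bracket f H K (hom_parallel (st_fun f) H) K2).
  by rewrite (st_bracket g _ _ H' K').
Defined.

Definition EtCat : category.
Proof.
apply: (@Category (stretching n) (@stretching_hom n) stretching_id
  stretching_comp); by move=> *; apply: stretching_hom_eq.
Defined.

Definition EtCat_forgetful : functor EtCat IGr.
Proof.
by apply: (@Functor EtCat IGr (fun E => st_magma E : igraph)
  (fun E E' f => st_fun f : igraph_hom (st_magma E) (st_magma E'))).
Defined.

End StretchingCategory.

(* A left adjoint is only determined up to isomorphism, so the monad and its
   algebras are relative to a chosen one, [F]. *)
Definition weak_cat n (F : left_adjoint (EtCat_forgetful n)) : Type :=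
  algebra (induced_monad F).

Section Operations.
Variables (n : nat) (F : left_adjoint (EtCat_forgetful n)) (G : weak_cat F).

Definition wgraph : igraph := carrier G.

Definition free_magma : nmagma n := st_magma (ladj F wgraph).

Definition waction : igraph_hom free_magma wgraph := action G.

Definition wunit : igraph_hom wgraph free_magma :=
  munit (induced_monad F) (carrier G).

Lemma wactionK m (x : wgraph m) : waction m (wunit m x) = x.
Proof.
have := action_unit G.
by move/(congr1 (fun f : igraph_hom wgraph wgraph => f m x)).
Qed.

Definition wcomp m p (h : p < m) (a b : wgraph m) (H : src h a = tgt h b) :
  wgraph m :=
  waction m (mcomp (wunit m a) (wunit m b) (hom_composable wunit H)).

Definition wrefl p m (h : p < m) (a : wgraph p) : wgraph m :=
  waction m (refl h (wunit p a)).

Definition wrev m p (hn : n <= p) (h : p < m) (a : wgraph m) : wgraph m :=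
  waction m (reversor hn h (wunit m a)).

Definition wrgraph : rgraph.
Proof.
apply: (@RGraph wgraph (fun m => wrefl (ltnSn m))) => m x.
  by rewrite /wrefl -hom_source /refl upS source_reflexor wactionK.
by rewrite /wrefl -hom_target /refl upS target_reflexor wactionK.
Defined.

Definition is_iso (a b : wgraph 0) (f : wgraph 1) : Prop :=
  exists g : wgraph 1, source g = b /\ target g = a /\
  exists (Hfg : src (ltnSn 0) f = tgt (ltnSn 0) g)
         (Hgf : src (ltnSn 0) g = tgt (ltnSn 0) f),
    wcomp Hfg = wrefl (ltnSn 0) b /\ wcomp Hgf = wrefl (ltnSn 0) a.

End Operations.

Arguments wcomp {n F G m p h} a b H.

(* Main.v *)
From mathcomp Require Import all_boot.
Require Import Defs.

Set Implicit Arguments.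
Unset Strict Implicit.
Unset Printing Implicit Defensive.

(** The inverse of f is the image under the action v of the formal reverse
    j(x) of the generator x = lambda(f) in the free magma M(G).

    The projection of M(G) onto its strict category sends reversors to strict
    inverses, so x * j(x) and the identity on the target of x have the same
    image there.  They are also parallel, and the stretching therefore contracts
    them: it supplies a 2-cell of M(G) from one to the other, which v carries to
    a 2-cell of G.  In dimension 1 that 2-cell is an identity, hence its two
    ends coincide ([waction_contract]) and v (x * j(x)) is the identity on b;
    likewise on the other side.

    What v (x * j(x)) has to be compared with is the composite in G of f and
    v (j(x)), namely v (x * lambda(v (j(x)))).  The two agree because v turns
    composites of arbitrary cells of M(G) into composites of G
    ([waction_mcomp]); this is where the associativity axiom of algebras is
    used.

    The argument works for (p+1)-cells and the composition along p-cells in any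
    weak (oo,n)-category with n <= p whose (p+2)-cells are all identities
    ([wcomp_wrev], [wrev_wcomp]). *)

Lemma identity_cell_ends (X : rgraph) m (x : X m.+1) :
  identity_cell x -> source x = target x.
Proof. by case=> y ->; rewrite source_reflexor target_reflexor. Qed.

Lemma parallel_faces (X : igraph) p (h : p < p.+1) (x y : X p.+1) :
  src h x = src h y -> tgt h x = tgt h y -> parallel x y.
Proof. by rewrite !srcS !tgtS. Qed.

Lemma hom_refl (M N : magma) (f : magma_hom M N) p m (h : p < m) (x : M p) :
  f m (refl h x) = refl h (f p x).
Proof.
elim: m h => // m IH h; case: (@leq_case p m h) => [e|h'].
  by subst m; rewrite /refl !upS hom_reflexor.
by rewrite /refl !(up_lt _ h h') hom_reflexor; congr reflexor; apply: IH.
Qed.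

Section WeakCategories.
Variables (n : nat) (F : left_adjoint (EtCat_forgetful n)) (G : weak_cat F).

Local Notation M := (free_magma G).
Local Notation proj := (st_proj (ladj F (wgraph G))).

(** The bracket of the stretching joins [c1] to [c0] by an (m+1)-cell of the
    free magma; its image under the action collapses to an identity. *)
Lemma waction_contract m (c1 c0 : M m) :
  (forall x : wrgraph G m.+1, identity_cell x) ->
  parallel c1 c0 -> proj m c1 = proj m c0 ->
  waction G m c1 = waction G m c0.
Proof.
move=> idG c10 Ec.
have := identity_cell_ends (idG (waction G m.+1 (bracket _ c1 c0 c10 Ec))).
by rewrite /= -hom_source -hom_target source_bracket target_bracket.
Qed.

(** Both sides are images of one composite of generators of the free magma on
    the graph underlying M(G): the left-hand side through the multiplication of
    the monad, the right-hand side through the functorial action of v.  These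
    two maps are morphisms of magmas, and the associativity of the algebra
    equates their composites with v. *)
Lemma waction_mcomp m p (h : p < m) (y x : M m) (H : src h y = tgt h x)
    (H' : src h (waction G m y) = tgt h (waction G m x)) :
  waction G m (mcomp y x H) = wcomp (waction G m y) (waction G m x) H'.
Proof.
pose mu : nmagma_hom _ M := st_fun (adj_counit F (ladj F (wgraph G))).
pose Tv : nmagma_hom _ M := st_fun (fmap (ladj F) (action G)).
pose u : igraph_hom M _ := adj_unit F (M : igraph).
have muK k (z : M k) : mu k (u k z) = z.
  have := mmul_unit_l (induced_monad F) (wgraph G).
  by move/(congr1 (fun g : igraph_hom M M => g k z)).
have TvE k (z : M k) : Tv k (u k z) = wunit G k (waction G k z).
  have := munit_nat (induced_monad F) (action G).
  by move/(congr1 (fun g : igraph_hom M M => g k z)) => /= <-.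
have vE k z : waction G k (mu k z) = waction G k (Tv k z).
  have := action_mul G.
  by move/(congr1 (fun g : igraph_hom _ (wgraph G) => g k z)).
have Hu := hom_composable u H.
have -> : mcomp y x H = mu m (mcomp (u m y) (u m x) Hu).
  by rewrite (hom_mcomp mu Hu (hom_composable mu Hu)); apply: mcomp_congr.
rewrite vE (hom_mcomp Tv Hu (hom_composable Tv Hu)) /wcomp.
by congr (waction G m _); apply: mcomp_congr.
Qed.

Variables (p : nat) (hn : n <= p) (h : p < p.+1).
Hypothesis idG : forall x : wrgraph G p.+2, identity_cell x.

Lemma source_wrev (f : wgraph G p.+1) : source (wrev hn h f) = target f.
Proof. by rewrite /wrev -hom_source source_rev_top -hom_target wactionK. Qed.

Lemma target_wrev (f : wgraph G p.+1) : target (wrev hn h f) = source f.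
Proof. by rewrite /wrev -hom_target target_rev_top -hom_source wactionK. Qed.

(** Codimension one is essential for the contraction: only then does the
    formal reversor exchange the faces of a cell, making the composite parallel
    to an identity. *)
Lemma wcomp_wrev (f : wgraph G p.+1) (H : src h f = tgt h (wrev hn h f)) :
  wcomp f (wrev hn h f) H = wrefl h (target f).
Proof.
set x := wunit G _ f; set jx := reversor hn h x.
(* As f is the image of its generator x, the composite in G is one of images. *)
have Hx : src h x = tgt h jx by rewrite srcS tgtS target_rev_top.
have Hv := hom_composable (waction G) Hx.
have -> : wcomp f (wrev hn h f) H =
          wcomp (waction G _ x) (waction G _ jx) Hv.
  congr (waction G _ _); apply: mcomp_congr => //.
  by rewrite /x wactionK.
rewrite -(waction_mcomp Hx Hv) /wrefl hom_target.
apply: waction_contract => //.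
  apply: (@parallel_faces _ _ h).
    by rewrite src_mcomp_le // src_refl srcS source_rev_top.
  by rewrite tgt_mcomp_le // tgt_refl tgtS.
rewrite (hom_refl proj) (hom_mcomp proj Hx (hom_composable proj Hx)).
have [K [_ [E _]]] := inverseP (C := st_scat _) hn h (proj _ x).
rewrite hom_target -(tgtS h) -E; apply: mcomp_congr => //.
exact: (hom_rev proj).
Qed.

Lemma wrev_wcomp (f : wgraph G p.+1) (H : src h (wrev hn h f) = tgt h f) :
  wcomp (wrev hn h f) f H = wrefl h (source f).
Proof.
set x := wunit G _ f; set jx := reversor hn h x.
have Hx : src h jx = tgt h x by rewrite srcS tgtS source_rev_top.
have Hv := hom_composable (waction G) Hx.
have -> : wcomp (wrev hn h f) f H =
          wcomp (waction G _ jx) (waction G _ x) Hv.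
  congr (waction G _ _); apply: mcomp_congr => //.
  by rewrite /x wactionK.
rewrite -(waction_mcomp Hx Hv) /wrefl hom_source.
apply: waction_contract => //.
  apply: (@parallel_faces _ _ h).
    by rewrite src_mcomp_le // src_refl srcS.
  by rewrite tgt_mcomp_le // tgt_refl tgtS target_rev_top.
rewrite (hom_refl proj) (hom_mcomp proj Hx (hom_composable proj Hx)).
have [_ [K [_ E]]] := inverseP (C := st_scat _) hn h (proj _ x).
rewrite hom_source -(srcS h) -E; apply: mcomp_congr => //.
exact: (hom_rev proj).
Qed.

End WeakCategories.

Theorem proposition1 (F : left_adjoint (EtCat_forgetful 0)) (G : weak_cat F)
  (dimG : has_dimension (wrgraph G) 1)
  (a b : wgraph G 0) (f : wgraph G 1)
  (fa : source f = a) (fb : target f = b) :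
  is_iso a b f.
Proof.
have idG : forall x : wrgraph G 2, identity_cell x by case: dimG => + _; exact.
set h := ltnSn 0; set g := wrev (leqnn 0) h f.
have gs : source g = b by rewrite source_wrev.
have gt : target g = a by rewrite target_wrev.
have Hfg : src h f = tgt h g by rewrite srcS tgtS fa gt.
have Hgf : src h g = tgt h f by rewrite srcS tgtS fb gs.
exists g; do 2!split=> //; exists Hfg, Hgf; split.
- by rewrite (wcomp_wrev idG Hfg) fb.
- by rewrite (wrev_wcomp idG Hgf) fa.
Qed.
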